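(* Let $\mathcal{P}=\{P_\theta:\theta\in\Theta\}$ be a statistical model on a measurable space $(\mathcal{X},\mathcal{A})$, each $P_\theta$ having a density with respect to a common $\sigma$-finite measure $\nu$, and let $\psi:\mathcal{P}\to\mathbb{R}^k$ be a functional. Let $(\Theta,\mathcal{T},\mu)$ be a measure space, let $\Theta_0\subseteq\Theta$ be any subset, and let $\mathcal{Q}=\mathcal{Q}(\Theta_0)$ be a collection of probability measures on $\Theta_0$ having a density with respect to $\mu$. Let $\Phi$ be any collection of functionals $\phi:\mathcal{P}\to\mathbb{R}^k$. Then for any measurable function $T:\mathcal{X}\to\mathbb{R}^k$ and any vector norm $\|\cdot\|:\mathbb{R}^k\to[0,\infty)$, $$\sup_{\theta\in\Theta_0}\mathbb{E}_{\theta}\|T(X)-\psi(P_\theta)\|^2\ \ge\ \sup_{\phi\in\Phi,\,Q\in\mathcal{Q}}\left[\left(\int \mathbb{E}_{\theta}\|T(X)-\phi(P_\theta)\|^2\,dQ(\theta)\right)^{1/2}-\left(\int\|\psi(P_\theta)-\phi(P_\theta)\|^2\,dQ(\theta)\right)^{1/2}\right]_+^2 .$$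
   Context: $\mathbb{E}_\theta$ denotes expectation when $X\sim P_\theta$. $[x]_+=\max(x,0)$ and $[x]_+^2=([x]_+)^2$. All functions are assumed measurable as needed for the displayed integrals to make sense; the bracket is read as $0$ when the second integral is infinite. *)

(* Defs.v *)
From HB Require Import structures.
From mathcomp Require Import all_boot all_order all_algebra.
From mathcomp Require Import all_classical all_reals all_analysis.
From mathcomp Require Import measurable_realfun.

Set Implicit Arguments.
Unset Strict Implicit.
Unset Printing Implicit Defensive.

Import Order.TTheory GRing.Theory Num.Theory.
Import numFieldNormedType.Exports.

Local Open Scope classical_set_scope.
Local Open Scope ring_scope.

(* An arbitrary norm on R^k: the canonical norm of ['rV[R]_k] is the sup norm,
   so a general one has to be a separate function. *)
Record vector_norm (R : realType) (k : nat) := VectorNorm {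
  vnorm :> 'rV[R]_k -> R ;
  vnorm_ge0 : forall x, 0 <= vnorm x ;
  vnorm_eq0 : forall x, vnorm x = 0 -> x = 0 ;
  vnormZ : forall (a : R) x, vnorm (a *: x) = `|a| * vnorm x ;
  vnormD : forall x y, vnorm (x + y) <= vnorm x + vnorm y }.

(* R^k with its Borel sigma-algebra. *)
Notation borel_rV R k := (g_sigma_algebraType (@open 'rV[R]_k)).

Definition has_density d (T : measurableType d) (R : realType)
    (m : set T -> \bar R) (p : set T -> \bar R) : Prop :=
  exists f : T -> R,
    [/\ measurable_fun [set: T] f,
        forall x, 0 <= f x &
        forall A, measurable A -> p A = (\int[m]_(x in A) (f x)%:E)%E].

Definition pointed_at (T : Type) (t0 : T) : Type := T.

HB.instance Definition _ (T : choiceType) (t0 : T) :=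
  Choice.on (pointed_at t0).
HB.instance Definition _ (T : choiceType) (t0 : T) :=
  isPointed.Build (pointed_at t0) t0.

Definition trace_val (T : Type) (D : set T) (t0 : D) : pointed_at t0 -> T :=
  val.
Arguments trace_val {T D} t0 _.

(* The subset D as a measurable space, with the trace sigma-algebra
   {D `&` A | A measurable}; D itself need not be measurable.  Measurable
   types are pointed in the library, so the type (not its sigma-algebra)
   carries a point of D. *)
Notation trace_space t0 := (g_sigma_algebra_preimageType (trace_val t0)).

(* The point is no restriction: only a nonempty D carries a probability. *)
Record probability_on (R : realType) d (T : measurableType d) (D : set T) :=
  ProbabilityOn {
    pon_point : D ;
    pon_prob :> probability (trace_space pon_point) R }.

(* Q has a density w.r.t. a measure m on T: Q (D `&` A) = \int[m]_(x in A) f x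
   for every measurable A. *)
Definition on_has_density d (T : measurableType d) (R : realType) (D : set T)
    (m : set T -> \bar R) (Q : probability_on R D) : Prop :=
  has_density m
    (fun A : set T => Q (trace_val (pon_point Q) @^-1` A)).

Section risk.
Context {d dT : measure_display} {X : measurableType d}
  {Theta : measurableType dT} {R : realType} {k : nat}.
Variables (P : Theta -> probability X R) (N : vector_norm R k).

(* [range P] is the model {P_theta}; functionals are defined on it, so they
   depend on theta only through P_theta. *)
Definition law (theta : Theta) : range P :=
  SigSub (mem_set (imageT P theta)).

(* E_theta ||T(X) - phi(P_theta)||^2 *)
Definition risk (T : X -> 'rV[R]_k) (phi : range P -> 'rV[R]_k)
    (theta : Theta) : \bar R :=
  'E_(P theta)[fun x => N (T x - phi (law theta)) ^+ 2].

(* ||psi(P_theta) - phi(P_theta)||^2 *)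
Definition sqdist (psi phi : range P -> 'rV[R]_k) (theta : Theta) : R :=
  N (psi (law theta) - phi (law theta)) ^+ 2.

Definition bayes_risk (Theta0 : set Theta) (T : X -> 'rV[R]_k)
    (phi : range P -> 'rV[R]_k) (Q : probability_on R Theta0) : \bar R :=
  (\int[Q]_(theta in [set: trace_space (pon_point Q)])
     risk T phi (trace_val (pon_point Q) theta))%E.

Definition bayes_sqdist (Theta0 : set Theta) (psi phi : range P -> 'rV[R]_k)
    (Q : probability_on R Theta0) : \bar R :=
  (\int[Q]_(theta in [set: trace_space (pon_point Q)])
     (sqdist psi phi (trace_val (pon_point Q) theta))%:E)%E.

End risk.

(* [a^(1/2) - b^(1/2)]_+, read as 0 when b is infinite. *)
Definition sqrt_gap (R : realType) (a b : \bar R) : \bar R :=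
  (if b == +oo then 0 else maxe (a `^ 2^-1 - b `^ 2^-1) 0)%E.

(* Main.v *)
Require Import Defs.
From mathcomp Require Import all_boot all_order all_algebra.
From mathcomp Require Import all_classical all_reals all_analysis.
From mathcomp Require Import measurable_realfun.
From mathcomp Require Import ring lra.

Import Order.TTheory GRing.Theory Num.Theory.
Import numFieldNormedType.Exports.

Local Open Scope classical_set_scope.
Local Open Scope ring_scope.

(** Write S for the supremum of the risk of psi over Theta0, and A, B for the
Q-averages of the risk of phi and of the squared distance of psi to phi.  The
bound is the triangle inequality in the L^2 space of the joint law of
(theta, X): T - phi is the sum of T - psi, whose squared norm is at most S
because Q averages over Theta0, and of psi - phi, whose squared norm is B.
Hence sqrt A <= sqrt S + sqrt B, which rearranges to the claim.

Here A and B are iterated integrals, and the joint law need not make sense: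
nothing says that theta |-> P_theta is a kernel, nor that the risk of psi is
measurable in theta.  So the L^2 triangle inequality is replaced by the family
of linear bounds
    (a + b)^2 <= (u + v) / u * a^2 + (u + v) / v * b^2      (u, v > 0),
which is Cauchy-Schwarz and survives any integration: apply it pointwise,
integrate in x ([risk_le_weighted]), bound the risk of psi by S, and only then
integrate in theta ([bayes_risk_le_weighted]).  Choosing u : v close to
sqrt S : sqrt B recovers A <= (sqrt S + sqrt B)^2 ([le_sqrrD_of_weighted]).

Integrating in x requires N (T - c) to be measurable for the Borel
sigma-algebra; this holds since every norm on R^k is Lipschitz for the sup
norm ([vnorm_le_norm]), hence continuous. *)

Lemma sqrrD_le_weighted {R : realFieldType} {u v : R} (a b : R) :
  0 < u -> 0 < v ->
  (a + b) ^+ 2 <= (u + v) / u * a ^+ 2 + (u + v) / v * b ^+ 2.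
Proof.
move=> u0 v0; rewrite -subr_ge0.
have -> : (u + v) / u * a ^+ 2 + (u + v) / v * b ^+ 2 - (a + b) ^+ 2 =
    (v * a - u * b) ^+ 2 / (u * v) by field; rewrite !gt_eqF.
by rewrite divr_ge0 ?sqr_ge0 // mulr_ge0 // ltW.
Qed.

(** The infimum over u and v of the weighted bounds is (s + b)^2, approached as
u : v tends to s : b; positive weights cannot be taken equal to s and b, which
may vanish. *)
Lemma le_sqrrD_of_weighted {R : realFieldType} {a s b : R} :
  0 <= s -> 0 <= b ->
  (forall u v : R, 0 < u -> 0 < v ->
     a <= (u + v) / u * s ^+ 2 + (u + v) / v * b ^+ 2) ->
  a <= (s + b) ^+ 2.
Proof.
move=> s0 b0 aP; apply/ler_addgt0Pr => e e0.
(* With u = s + h and v = b + h the bound is at most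
   (s + b + 2 h) (s + b) = (s + b)^2 + 2 h (s + b). *)
pose D := 2 * (s + b) + 1.
have D0 : 0 < D by rewrite /D; lra.
pose h := e / D.
have h0 : 0 < h by rewrite divr_gt0.
have sh0 : 0 < s + h by lra.
have bh0 : 0 < b + h by lra.
have shrink (x : R) : 0 <= x -> 0 < x + h -> x ^+ 2 / (x + h) <= x.
  by move=> x0 xh0; rewrite ler_pdivrMr // expr2 ler_wpM2l //; lra.
apply: (le_trans (aP _ _ sh0 bh0)).
apply: (@le_trans _ _ ((s + h + (b + h)) * (s + b))).
  rewrite -!mulrA -mulrDr ler_wpM2l //; first lra.
  by rewrite ![_^-1 * _]mulrC lerD // shrink.
have he : e = h * D by rewrite /h divfK // gt_eqF.
by rewrite he /D; nra.
Qed.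

Lemma vnorm0 {R : realType} {k : nat} (N : vector_norm R k) : N 0 = 0.
Proof. by rewrite -(scale0r 0) vnormZ normr0 mul0r. Qed.

Lemma vnormN {R : realType} {k : nat} (N : vector_norm R k) x :
  N (- x) = N x.
Proof. by rewrite -scaleN1r vnormZ normrN normr1 mul1r. Qed.

(** Expand x in the canonical basis; each coordinate is at most the sup norm
of x. *)
Lemma vnorm_le_norm {R : realType} {k : nat} (N : vector_norm R k) x :
  N x <= (\sum_(j < k) N 'e_j) * `|x|.
Proof.
rewrite {1}[x]row_sum_delta mulr_suml.
apply: (@le_trans _ _ (\sum_(j < k) N (x 0 j *: 'e_j))).
  elim/big_ind2: _ => [|u a v b ua vb|//]; first by rewrite vnorm0.
  exact: le_trans (vnormD _ _ _) (lerD ua vb).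
apply: ler_sum => j _; rewrite vnormZ mulrC ler_wpM2l ?vnorm_ge0 //.
rewrite [`|x|]mx_normrE; exact: (le_bigmax _ (fun i => `|x i.1 i.2|) (0, j)).
Qed.

(** The reverse triangle inequality and [vnorm_le_norm] make the norm Lipschitz
for the sup norm, which defines the topology. *)
Lemma vnormB_continuous {R : realType} {k : nat} (N : vector_norm R k)
    (c : 'rV[R]_k) :
  continuous (fun x : 'rV[R]_k => N (x - c)).
Proof.
pose C := \sum_(j < k) N 'e_j.
have C0 : 0 <= C by apply: sumr_ge0 => j _; exact: vnorm_ge0.
have lip x y : `|N (x - c) - N (y - c)| <= C * `|x - y|.
  apply: le_trans (vnorm_le_norm N (x - y)).
  have xy := vnormD N (x - y) (y - c); rewrite addrA subrK in xy.
  have yx := vnormD N (y - x) (x - c); rewrite addrA subrK in yx.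
  by rewrite -(opprB x y) vnormN in yx; rewrite ler_norml; lra.
move=> x; apply/(@cvgrPdist_le _ _ _ _ (nbhs_filter x)) => e e0.
(* C is zero when k is, hence the division by C + 1. *)
have d0 : 0 < e / (C + 1) by rewrite divr_gt0 //; lra.
apply/nbhs_ballP; exists (e / (C + 1)) => //= y.
rewrite -ball_normE /= => /ltW xy.
apply: (le_trans (lip x y)); apply: (@le_trans _ _ (C * (e / (C + 1)))).
  by rewrite ler_wpM2l.
by rewrite mulrCA ger_pMr // ler_pdivrMr; lra.
Qed.

Lemma measurable_vnormB {R : realType} {k : nat} (N : vector_norm R k)
    {d : measure_display} {X : measurableType d} (T : X -> 'rV[R]_k)
    (c : 'rV[R]_k) :
  measurable_fun [set: X] (T : X -> borel_rV R k) ->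
  measurable_fun [set: X] (fun x => N (T x - c)).
Proof.
move=> mT; apply: (measurability _ (RGenOpens.measurableE R)).
move=> _ [_ [a [b ->]] <-].
apply: (mT measurableT ((fun y => N (y - c)) @^-1` `]a, b[)).
apply: sub_sigma_algebra.
by move/continuousP : (vnormB_continuous N c); apply; exact: interval_open.
Qed.

Section risk_bounds.
Context {R : realType} {k : nat} {d dT : measure_display}
  {X : measurableType d} {Theta : measurableType dT}.
Variables (P : Theta -> probability X R) (N : vector_norm R k)
  (T : X -> 'rV[R]_k).

Lemma risk_ge0 (phi : range P -> 'rV[R]_k) theta :
  (0 <= risk N T phi theta)%E.
Proof. by apply: expectation_ge0 => x; exact: sqr_ge0. Qed.

(** The triangle inequality for N inside the weighted bound, integrated
in x; the distance of psi to phi is constant in x and P_theta has mass one. *)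
Lemma risk_le_weighted (T_meas : measurable_fun [set: X] (T : X -> borel_rV R k))
    (psi phi : range P -> 'rV[R]_k) (u v : R) theta : 0 < u -> 0 < v ->
  (risk N T phi theta <= ((u + v) / u)%:E * risk N T psi theta
     + ((u + v) / v * sqdist N psi phi theta)%:E)%E.
Proof.
move=> u0 v0; rewrite /risk unlock.
have c1 : 0 <= (u + v) / u by rewrite divr_ge0 ?ltW // addr_gt0.
have c2 : 0 <= (u + v) / v * sqdist N psi phi theta.
  by rewrite mulr_ge0 ?sqr_ge0 // divr_ge0 ?ltW // addr_gt0.
have mN c : measurable_fun [set: X] (fun x => (N (T x - c) ^+ 2)%:E).
  by apply/measurable_EFinP; apply: measurable_funX; exact: measurable_vnormB.
have N0 c x : (0 <= (N (T x - c) ^+ 2)%:E)%E by rewrite lee_fin sqr_ge0.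
(* Write the constant as an integral to merge both terms into one. *)
rewrite -[X in (_ <= _ + X)%E]mule1 -(probability_setT (P theta)).
rewrite -integral_cst // -ge0_integralZl_EFin // -ge0_integralD //; last 2 first.
- by move=> x _; rewrite mule_ge0.
- exact: measurable_funeM.
apply: ge0_le_integral => //.
  by apply: emeasurable_funD => //; exact: measurable_funeM.
move=> x _; rewrite -EFinM -EFinD lee_fin.
apply: (le_trans _ (sqrrD_le_weighted _ _ u0 v0)).
rewrite lerXn2r ?nnegrE ?addr_ge0 ?vnorm_ge0 //.
by apply: le_trans (vnormD _ _ _); rewrite addrA subrK.
Qed.

Lemma bayes_risk_ge0 (Theta0 : set Theta) (phi : range P -> 'rV[R]_k)
    (Q : probability_on R Theta0) : (0 <= bayes_risk N T phi Q)%E.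
Proof. by apply: integral_ge0 => theta _; exact: risk_ge0. Qed.

Lemma bayes_sqdist_ge0 (Theta0 : set Theta) (psi phi : range P -> 'rV[R]_k)
    (Q : probability_on R Theta0) : (0 <= bayes_sqdist N psi phi Q)%E.
Proof. by apply: integral_ge0 => theta _; rewrite lee_fin sqr_ge0. Qed.

(** Replacing the risk of psi by the constant S before integrating in theta
leaves only functions of theta that are measurable by hypothesis. *)
Lemma bayes_risk_le_weighted
    (T_meas : measurable_fun [set: X] (T : X -> borel_rV R k))
    (Theta0 : set Theta) (Q : probability_on R Theta0)
    (psi phi : range P -> 'rV[R]_k) (S u v : R) :
  measurable_fun [set: trace_space (pon_point Q)]
    (risk N T phi \o trace_val (pon_point Q)
       : trace_space (pon_point Q) -> \bar R) ->
  measurable_fun [set: trace_space (pon_point Q)]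
    (sqdist N psi phi \o trace_val (pon_point Q)
       : trace_space (pon_point Q) -> R) ->
  (forall theta, Theta0 theta -> (risk N T psi theta <= S%:E)%E) ->
  0 < u -> 0 < v ->
  (bayes_risk N T phi Q <=
     ((u + v) / u * S)%:E + ((u + v) / v)%:E * bayes_sqdist N psi phi Q)%E.
Proof.
move=> mrisk msq riskS u0 v0.
have c1 : 0 <= (u + v) / u by rewrite divr_ge0 ?ltW // addr_gt0.
have c2 : 0 <= (u + v) / v by rewrite divr_ge0 ?ltW // addr_gt0.
have S0 : 0 <= S.
  rewrite -lee_fin; apply: le_trans (riskS _ (set_valP (pon_point Q))).
  exact: risk_ge0.
have sq0 theta : (0 <= (sqdist N psi phi theta)%:E)%E.
  by rewrite lee_fin sqr_ge0.
have msqE : measurable_fun [set: trace_space (pon_point Q)]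
    (fun theta => (sqdist N psi phi (trace_val (pon_point Q) theta))%:E).
  exact/measurable_EFinP.
rewrite -[X in (_ <= X + _)%E]mule1 -(probability_setT Q).
rewrite /bayes_sqdist /bayes_risk.
rewrite -integral_cst // -ge0_integralZl_EFin // -ge0_integralD //; last 3 first.
- by move=> theta _; rewrite lee_fin mulr_ge0.
- by move=> theta _; rewrite mule_ge0.
- exact: measurable_funeM.
apply: ge0_le_integral => //.
- by move=> theta _; exact: risk_ge0.
- by apply: emeasurable_funD => //; exact: measurable_funeM.
move=> theta _.
apply: (le_trans (risk_le_weighted T_meas psi _ _ _ _ u0 v0)).
rewrite /= !EFinM leeD2r // lee_wpmul2l ?lee_fin //.
exact: (riskS _ (set_valP theta)).
Qed.

End risk_bounds.

(** The rearrangement of sqrt a <= s + sqrt b, in the extended reals: when b is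
finite the hypothesis forces a to be finite, so that no difference of
infinities arises. *)
Lemma sqrt_gap_sqr_le {R : realType} {a b : \bar R} {s : R} :
  (0 <= a)%E -> (0 <= b)%E -> 0 <= s ->
  (forall u v : R, 0 < u -> 0 < v ->
     (a <= ((u + v) / u * s ^+ 2)%:E + ((u + v) / v)%:E * b)%E) ->
  (sqrt_gap a b ^+ 2 <= (s ^+ 2)%:E)%E.
Proof.
rewrite /sqrt_gap => a0 b0 s0 aP; case: eqP => [_|/eqP].
  by rewrite -EFin_expe lee_fin expr0n sqr_ge0.
case: b b0 aP => [b||] // b0 aP _; rewrite lee_fin in b0.
case: a a0 aP => [a||] // a0 aP; last first.
  by have := aP 1 1 ltr01 ltr01; rewrite -EFinM -EFinD leye_eq.
rewrite lee_fin in a0.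
have ab : Num.sqrt a <= s + Num.sqrt b.
  rewrite -(@ger0_norm _ (s + Num.sqrt b)) ?addr_ge0 ?sqrtr_ge0 //.
  rewrite -sqrtr_sqr ler_wsqrtr // le_sqrrD_of_weighted ?sqrtr_ge0 // => u v u0 v0.
  by rewrite sqr_sqrtr // -lee_fin EFinD [X in (_ <= _ + X)%E]EFinM aP.
rewrite !poweR_EFin !powR12_sqrt // -EFinB -EFin_max -EFin_expe lee_fin.
rewrite lerXn2r ?nnegrE ?le_max ?lexx ?orbT // ge_max s0 andbT.
by rewrite lerBlDr.
Qed.

Theorem lemma4 (R : realType) (k : nat)
    (d : measure_display) (X : measurableType d)
    (nu : {sigma_finite_measure set X -> \bar R})
    (dT : measure_display) (Theta : measurableType dT)
    (mu : {measure set Theta -> \bar R})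
    (P : Theta -> probability X R)
    (P_density : forall theta, has_density nu (P theta))
    (psi : range P -> 'rV[R]_k)
    (Theta0 : set Theta)
    (QQ : set (probability_on R Theta0))
    (QQ_density : forall Q, QQ Q -> on_has_density mu Q)
    (Phi : set (range P -> 'rV[R]_k))
    (T : X -> 'rV[R]_k)
    (T_meas : measurable_fun [set: X] (T : X -> borel_rV R k))
    (N : vector_norm R k)
    (risk_meas : forall phi, Phi phi -> forall t0 : Theta0,
       measurable_fun [set: trace_space t0]
         (risk N T phi \o trace_val t0 : trace_space t0 -> \bar R))
    (sqdist_meas : forall phi, Phi phi -> forall t0 : Theta0,
       measurable_fun [set: trace_space t0]
         (sqdist N psi phi \o trace_val t0 : trace_space t0 -> R)) :
  (ereal_sup [set sqrt_gap (bayes_risk N T phi Q) (bayes_sqdist N psi phi Q) ^+ 2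
             | phi in Phi & Q in QQ]
   <= ereal_sup [set risk N T psi theta | theta in Theta0])%E.
Proof.
apply: ge_ereal_sup => _ [phi Phi_phi [Q QQ_Q <-]].
set S := ereal_sup _.
have riskS theta : Theta0 theta -> (risk N T psi theta <= S)%E.
  by move=> ?; apply: ereal_sup_ubound; exists theta.
have S0 : (0 <= S)%E.
  apply: le_trans (riskS _ (set_valP (pon_point Q))); exact: risk_ge0.
case: S S0 riskS => [S||] // S0 riskS; last by rewrite leey.
rewrite lee_fin in S0; rewrite -[S]sqr_sqrtr //.
apply: sqrt_gap_sqr_le; rewrite ?sqrtr_ge0 ?bayes_risk_ge0 ?bayes_sqdist_ge0 //.
move=> u v u0 v0; rewrite sqr_sqrtr //.
apply: bayes_risk_le_weighted => //.
- exact: risk_meas.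
- exact: sqdist_meas.
Qed.
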